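(* Let $Q$ be a polyhedral partially ordered abelian group and let $D\subseteq Q$ be a downset. Then $D=\bigcup_{\tau}\Gamma_\tau(D_\tau)$, the union of its local $\tau$-supports over all faces $\tau$ of the positive cone $Q_+$.
   Context: An abelian group $Q$ is partially ordered if it is generated by a submonoid $Q_+$ (the positive cone) with trivial unit group; the order is $q\preceq q'\iff q'-q\in Q_+$. A face of $Q_+$ is a submonoid $\sigma\subseteq Q_+$ such that $Q_+\setminus\sigma$ is an ideal of the monoid $Q_+$. $Q$ is polyhedral if it has only finitely many faces. A downset is a subset $D\subseteq Q$ with $D-Q_+=D$ (closed under going down). For a downset $D$ and a face $\tau$, the localization of $D$ along $\tau$ is $D_\tau=\{q\in D\mid q+\tau\subseteq D\}$, which is again a downset. An element $q\in D$ is globally supported on $\tau$ if $q\notin D_{\tau'}$ for every face $\tau'\not\subseteq\tau$; $\Gamma_\tau D$ denotes the set of elements of $D$ globally supported on $\tau$. The local $\tau$-support of $D$ is $\Gamma_\tau(D_\tau)$, the set of elements globally supported on $\tau$ in the downset $D_\tau$. *)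

(* Defs.v *)
From mathcomp Require Import all_boot all_algebra.
From mathcomp Require Import classical_sets cardinality.

Set Implicit Arguments.
Unset Strict Implicit.
Unset Printing Implicit Defensive.

Import GRing.Theory.
Local Open Scope ring_scope.
Local Open Scope classical_set_scope.

Section PartiallyOrderedAbelianGroups.
Variable Q : zmodType.
Implicit Types S P D I sigma tau : set Q.

Definition submonoid S : Prop :=
  S 0 /\ (forall x y, S x -> S y -> S (x + y)).

Definition subgroup S : Prop :=
  submonoid S /\ (forall x, S x -> S (- x)).

Definition trivial_units P : Prop :=
  [set x | P x /\ P (- x)] = [set 0].

(* [P] is the positive cone; the induced order is [q <= q'] iff [P (q' - q)]. *)
Definition positive_cone P : Prop :=
  [/\ submonoid P, trivial_units P & smallest subgroup P = [set: Q]].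

(* The empty set counts as an ideal, so that [P] is a face of itself. *)
Definition monoid_ideal P I : Prop :=
  I `<=` P /\ (forall x p, I x -> P p -> I (x + p)).

Definition face P sigma : Prop :=
  [/\ submonoid sigma, sigma `<=` P & monoid_ideal P (P `\` sigma)].

Definition faces P : set (set Q) := [set sigma | face P sigma].

Definition polyhedral P : Prop := finite_set (faces P).

Definition downset P D : Prop := [set q - p | q in D & p in P] = D.

Definition localization D tau : set Q :=
  [set q | D q /\ [set q + t | t in tau] `<=` D].

Definition global_support P tau D : set Q :=
  [set q | D q /\
    forall tau', face P tau' -> ~ (tau' `<=` tau) -> ~ localization D tau' q].

Definition local_support P tau D : set Q :=
  global_support P tau (localization D tau).

End PartiallyOrderedAbelianGroups.

(* Main.v *)
Require Import Defs.
From mathcomp Require Import all_boot all_algebra.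
From mathcomp Require Import boolp classical_sets cardinality.

(** The only inclusion with content is that every [q] in [D] lies in some local
    support.  Among the faces [tau] with [q + tau] contained in [D], choose one
    that is maximal for inclusion: [{0}] is such a face because [P] has no
    nonzero units, and a maximal one exists because there are finitely many
    faces ([finite_set_maximal]).  Then [q] lies in [D_tau], and if it also lies
    in the further localization of [D_tau] along a face [tau'], then
    [q + tau + tau'] is contained in [D].  The smallest face containing [tau]
    and [tau'] consists of the elements of [P] that lie below some [t + t'];
    since [D] is closed downwards, [q] plus this face is still contained in [D]
    ([localization_join_face]).  Maximality forces the join to be [tau], so
    that [tau'] is contained in [tau]; this says that [q] is globally supported
    on [tau] in [D_tau]. *)

Set Implicit Arguments.
Unset Strict Implicit.
Unset Printing Implicit Defensive.

Import GRing.Theory.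
Local Open Scope ring_scope.
Local Open Scope classical_set_scope.

Lemma finite_set_maximal (T : Type) (F : set (set T)) :
  finite_set F -> F !=set0 ->
  exists2 m, F m & forall b, F b -> m `<=` b -> b `<=` m.
Proof.
move=> /finite_seqP[s Fs] [a Fa].
(* Scanning a list, the current candidate is replaced only by a larger member;
   nothing above the new candidate can then beat it among the members already
   scanned, as it would have beaten the old one. *)
suff H : forall r : seq (set T), exists2 m, F m &
    forall b, b \in r -> F b -> m `<=` b -> b `<=` m.
  have [m Fm max_m] := H s; exists m => // b Fb; apply: max_m => //.
  by move: Fb; rewrite Fs.
elim=> [|c r [m Fm max_m]]; first by exists a.
have [[Fc mc]|nc] := pselect (F c /\ m `<=` c).
  exists c => // b; rewrite inE => /predU1P[-> //|rb] Fb cb.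
  apply: subset_trans (mc); apply: max_m => //.
  exact: subset_trans mc cb.
exists m => // b; rewrite inE => /predU1P[->|rb] Fb mb; last exact: max_m.
by case: nc.
Qed.

Section Faces.
Variables (Q : zmodType) (P : set Q).
Implicit Types (D tau : set Q) (q : Q).

Lemma face0 : submonoid P -> trivial_units P -> face P [set 0].
Proof.
move=> [P0 PD] Punits; split.
- by split=> [|x y -> ->] //=; rewrite addr0.
- by move=> x ->.
- split=> [x []//|x p [Px x0] Pp]; split; first exact: PD.
  move=> /= xp0; apply: x0; rewrite -Punits; split=> //.
  by rewrite -[- x]addr0 -xp0 addKr.
Qed.

(** When a sum of elements of [P] lies in a face, so do the summands; hence a face
    containing [tau] and [tau'] contains every [x] in [P] with [x + p = t + t']
    for some [p] in [P]; these [x] already form a face. *)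
Definition join_face tau tau' : set Q :=
  [set x | P x /\ exists2 p, P p & [set t + t' | t in tau & t' in tau'] (x + p)].

Lemma face_join_face tau tau' :
  submonoid P -> submonoid tau -> submonoid tau' ->
  face P (join_face tau tau').
Proof.
move=> [P0 PD] [tau0 tauD] [tau0' tauD']; split.
- split.
    by split=> //; exists 0 => //; exists 0 => //; exists 0 => //.
  move=> x y [Px [p Pp [t tt [t' tt' e]]]] [Py [r Pr [u tu [u' tu' f]]]].
  split; first exact: PD.
  exists (p + r); first exact: PD.
  exists (t + u); first exact: tauD.
  exists (t' + u'); first exact: tauD'.
  by rewrite addrACA e f addrACA.
- by move=> x [].
- split=> [x []//|x p [Px nx] Pp]; split; first exact: PD.
  move=> [_ [r Pr xpr]]; apply: nx; split=> //.
  by exists (p + r); [exact: PD|rewrite addrA].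
Qed.

Lemma sub_join_facel tau tau' :
  P 0 -> tau `<=` P -> tau' 0 -> tau `<=` join_face tau tau'.
Proof.
move=> P0 tauP tau0' t tt; split; first exact: tauP.
by exists 0 => //; exists t => //; exists 0.
Qed.

Lemma sub_join_facer tau tau' :
  P 0 -> tau' `<=` P -> tau 0 -> tau' `<=` join_face tau tau'.
Proof.
move=> P0 tauP' tau0 t tt; split; first exact: tauP'.
by exists 0 => //; exists 0 => //; exists t => //; rewrite addrC.
Qed.

(** With [x + p = t + t'], the element [q + x] is [p] below [q + t' + t], and
    the latter lies in [D] by the iterated localization. *)
Lemma localization_join_face D tau tau' q :
  downset P D ->
  localization (localization D tau) tau' q ->
  localization D (join_face tau tau') q.
Proof.
move=> hD [[Dq _] locq]; split=> // _ [x [Px [p Pp [t tt [t' tt' e]]]] <-].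
have [_ locqt'] : localization D tau (q + t') by apply: locq; exists t'.
rewrite -hD; exists (q + t' + t); first by apply: locqt'; exists t.
by exists p => //; rewrite -(addrA q) [t' + t]addrC e addrA addrK.
Qed.

End Faces.

Theorem theorem3p19 (Q : zmodType) (P : set Q)
    (hP : positive_cone P) (hpoly : polyhedral P)
    (D : set Q) (hD : downset P D) :
  D = \bigcup_(tau in faces P) local_support P tau D.
Proof.
have [Pmon Punits _] := hP.
apply/seteqP; split=> [q Dq|q [tau _ [[]]] //].
have [||tau [ftau locq] max_tau] :=
    @finite_set_maximal _ [set tau | face P tau /\ localization D tau q].
- by apply: sub_finite_set hpoly => tau [].
- exists [set 0]; split; first exact: face0.
  by split=> // _ [_ -> <-]; rewrite addr0.
exists tau => //; split=> // tau' ftau' ntau' locq'; apply: ntau'.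
have [mtau tauP _] := ftau; have [mtau' tauP' _] := ftau'.
have [P0 _] := Pmon.
apply: (subset_trans (sub_join_facer P0 tauP' mtau.1)).
apply: max_tau; last exact: sub_join_facel P0 tauP mtau'.1.
by split; [exact: face_join_face | exact: localization_join_face].
Qed.
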